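(* Let $P=(V,\le_P)$ and $Q=(U,\le_Q)$ be posets such that every module of $P$ distinct from $V$ is finite and totally ordered. The following are equivalent: (i) $P$ embeds into $Q$ or into the dual $Q^*$; (ii) $\mathrm{Comp}(P)$ embeds into $\mathrm{Comp}(Q)$; (iii) $\mathrm{Inc}(P)$ embeds into $\mathrm{Inc}(Q)$.
   Context: A module of a poset $(V,\le)$ is a set $A\subseteq V$ such that each $v\in V\setminus A$ is either below all, above all, or incomparable to all elements of $A$. $Q^*$ is the dual poset. $\mathrm{Comp}(P)$ (resp. $\mathrm{Inc}(P)$) is the graph on $V$ whose edges are pairs of distinct comparable (resp. incomparable) elements. Embedding means isomorphism onto an induced substructure. *)

(* Defs.v *)
From mathcomp Require Import all_boot all_order.
From mathcomp Require Import boolp classical_sets cardinality.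
Set Implicit Arguments.
Unset Strict Implicit.
Unset Printing Implicit Defensive.

Local Open Scope classical_set_scope.
Local Open Scope order_scope.

Definition poset_module (d : Order.disp_t) (V : porderType d) (A : set V) :
    Prop :=
  forall v : V, ~ A v ->
    [\/ forall a, A a -> v <= a,
        forall a, A a -> a <= v
      | forall a, A a -> v >< a].

Definition poset_embeds (d d' : Order.disp_t) (V : porderType d)
    (U : porderType d') : Prop :=
  exists f : V -> U, injective f /\ {mono f : x y / x <= y}.

(* A graph is given by its edge relation. Nothing here forces e and e' to be
   symmetric and irreflexive; Comp and Inc below are. *)
Definition graph_embeds (V U : Type) (e : rel V) (e' : rel U) : Prop :=
  exists f : V -> U, injective f /\ forall x y, e' (f x) (f y) = e x y.

Definition Comp (d : Order.disp_t) (V : porderType d) : rel V :=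
  [rel x y | (x != y) && (x >=< y)].

Definition Inc (d : Order.disp_t) (V : porderType d) : rel V :=
  [rel x y | (x != y) && (x >< y)].

Arguments poset_embeds {d d'} V U.
Arguments Comp {d} V.
Arguments Inc {d} V.

(* Main.v *)
(** Comp and Inc determine each other, so only "Comp(P) embeds into Comp(Q)
    implies P embeds into Q or Q^*" needs an argument.  The embedding pulls the
    order of Q back to a second transitive orientation r of Comp(P), which colours
    each pair of elements of P: r agrees with <, r disagrees with <, or the pair is
    incomparable.  No triangle carries all three colours.

    Suppose some x is joined to an incomparable pair y, z by two edges of the same
    colour (a "cherry").  The Gallai forcing class of xy spans a graph module
    containing y and z; as proper modules of P are chains, it spans P.  Cherries
    cannot occur in both colours: two spanning forcing classes of different colours
    meet at a vertex, giving a triangle with edges of both colours, one of which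
    is in a spanning class and is joined to the opposite vertex by two edges of
    the other colour.  Forcing propagates this to the whole class, hence to an
    edge at that vertex itself, which is absurd.

    So, up to replacing r by its reversal, there is no cherry of disagreement
    edges.  The connected components of disagreement are then finite chains and
    modules of P, and permuting each of them turns < into r. *)
Require Import Defs.
From Stdlib Require Import Operators_Properties Relation_Operators.
From mathcomp Require Import all_boot all_order.
From mathcomp Require Import boolp classical_sets cardinality.
From mathcomp Require finmap.
Set Implicit Arguments.
Unset Strict Implicit.
Unset Printing Implicit Defensive.

Import Order.TTheory.

Local Open Scope classical_set_scope.
Local Open Scope order_scope.

(** * Transitive orientations and the two colours of comparable pairs *)

Definition transitive_orientation (d : Order.disp_t) (P : porderType d)
    (r : rel P) : Prop :=
  [/\ irreflexive r, transitive r &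
      forall x y, r x y || r y x = (x < y) || (y < x)].

Definition reversal (T : Type) (r : rel T) : rel T := fun x y => r y x.

(* [reversed_edge r] is the relation "[<] and [r] disagree on the edge [xy]", so
   [reversed_edge (reversal r)] is "they agree on it". *)
Definition reversed_edge (d : Order.disp_t) (P : porderType d) (r : rel P) :
    rel P :=
  fun x y => (x < y) && r y x || (y < x) && r x y.

Section Reorientation.
Variables (d : Order.disp_t) (P : porderType d).
Implicit Types (r : rel P) (x y z v : P) (W : set P).

Lemma incomparable_sym x y : (x >< y) = (y >< x).
Proof. by rewrite comparable_sym. Qed.

Lemma transitive_orientation_reversal r :
  transitive_orientation r -> transitive_orientation (reversal r).
Proof.
move=> [ir tr cr]; split=> [x|y x z xy yz|x y]; rewrite /reversal ?ir //.
- exact: tr yz xy.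
- by rewrite orbC cr.
Qed.

Lemma reversed_edge_sym r x y : reversed_edge r x y = reversed_edge r y x.
Proof. by rewrite /reversed_edge orbC. Qed.

Lemma reversed_edge_irr r x : reversed_edge r x x = false.
Proof. by rewrite /reversed_edge ltxx. Qed.

Lemma reversed_edge_comparable r x y : reversed_edge r x y -> x >=< y.
Proof.
by case/orP=> /andP[/ltW xy _]; [apply: le_comparable | apply: ge_comparable].
Qed.

Lemma orientation_asym r x y : transitive_orientation r -> r x y -> r y x = false.
Proof.
by move=> [ir tr _] xy; apply/negP=> yx; have := tr _ _ _ xy yx; rewrite ir.
Qed.

Lemma comparable_edge_cases r x y : transitive_orientation r -> x >=< y ->
  [\/ x = y, reversed_edge r x y | reversed_edge (reversal r) x y].
Proof.
move=> [_ _ cr] xy; have := cr x y; rewrite /reversed_edge /reversal.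
case: (comparable_ltgtP xy) => [_|_|->]; last by constructor 1.
- by case/orP=> ->; [constructor 3 | constructor 2].
- by case/orP=> ->; [constructor 2 | constructor 3]; rewrite ?orbT.
Qed.

Lemma reversed_edge_disjoint r x y : transitive_orientation r ->
  reversed_edge r x y -> reversed_edge (reversal r) x y -> False.
Proof.
move=> or; rewrite /reversed_edge /reversal.
case/orP=> /andP[xy rxy]; case/orP=> /andP[yx ryx].
- by rewrite (orientation_asym or rxy) in ryx.
- by have := lt_trans xy yx; rewrite ltxx.
- by have := lt_trans xy yx; rewrite ltxx.
- by rewrite (orientation_asym or rxy) in ryx.
Qed.

(** The two colours differ, so exactly one of [<] and [r] directs the path [x], [y], [z]
    consistently through [y]; transitivity of that order compares [x] with [z]. *)
Lemma no_rainbow r x y z : transitive_orientation r ->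
  reversed_edge r x y -> reversed_edge (reversal r) y z -> x >=< z.
Proof.
move=> [ir tr cr]; rewrite /reversed_edge /reversal.
have rcomp u v : r u v -> u >=< v.
  move=> uv; have := cr u v; rewrite uv /=; case/esym/orP=> /ltW.
    exact: le_comparable.
  exact: ge_comparable.
case/orP=> /andP[xy rxy]; case/orP=> /andP[yz ryz].
- exact/le_comparable/ltW/(lt_trans xy).
- by rewrite comparable_sym; apply/rcomp/(tr y).
- by apply/rcomp/(tr y).
- exact/ge_comparable/ltW/(lt_trans yz).
Qed.

(* Gallai's forcing classes: if [<] and [r] disagree on the edge [xy], and [z] is
   incomparable to [y] and adjacent to [x], then they also disagree on [xz]. *)
Inductive forced r (x0 y0 : P) : P -> P -> Prop :=
| forced_refl : forced r x0 y0 x0 y0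
| forced_sym x y : forced r x0 y0 x y -> forced r x0 y0 y x
| forced_step x y z : forced r x0 y0 x y -> reversed_edge r x z -> y >< z ->
    forced r x0 y0 x z.

Lemma forced_reversed_edge r x0 y0 x y : reversed_edge r x0 y0 ->
  forced r x0 y0 x y -> reversed_edge r x y.
Proof.
by move=> e0; elim=> // {}x {}y _; rewrite reversed_edge_sym.
Qed.

(** * Modules of the comparability graph and spans of forcing classes *)

Definition graph_module W :=
  forall v, ~ W v ->
    (forall a, W a -> v >< a) \/ (forall a, W a -> v >=< a).

(** For [v] outside the span, incomparability to one end of a forced edge passes to the other end.
    Otherwise [v] would be joined to that other end: a disagreement edge would be forced, putting
    [v] in the span, and an agreement edge would give comparability to the first end by
    [no_rainbow]. *)
Lemma forced_span_module r x0 y0 : transitive_orientation r ->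
  reversed_edge r x0 y0 -> graph_module [set x | exists y, forced r x0 y0 x y].
Proof.
move=> or e0 v /= Nv.
have step x y : forced r x0 y0 x y -> v >< x -> v >< y.
  move=> xy vx; apply/negP=> vy.
  case: (comparable_edge_cases or vy) => [vy0|vyD|vyA].
  - by apply: Nv; exists x; rewrite vy0; apply: forced_sym.
  - apply: Nv; exists y; apply: forced_sym; apply: (@forced_step _ _ _ _ x).
    + exact: forced_sym.
    + by rewrite reversed_edge_sym.
    + by rewrite incomparable_sym.
  - move/negP: vx; apply; rewrite comparable_sym.
    apply: (no_rainbow or (forced_reversed_edge e0 xy)).
    by rewrite reversed_edge_sym.
have stepE x y : forced r x0 y0 x y -> (v >< x) = (v >< y).
  by move=> xy; apply/idP/idP; apply: step => //; apply: forced_sym.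
have all x y : forced r x0 y0 x y -> (v >< x) = (v >< x0).
  elim=> [//|{}x {}y xy IH|//].
  by rewrite -(stepE x).
have [vx0|vx0] := boolP (v >< x0).
- by left=> a [b ab]; rewrite (all _ _ ab).
- by right=> a [b ab]; rewrite -[_ >=< _]negbK (all _ _ ab).
Qed.

(** At a forcing step from [xy] to [xz], [no_rainbow] at [x] makes [a] comparable to [z]. The pair
    [az] cannot be a disagreement edge, since [no_rainbow] at [a] would then compare [y] with
    [z]. *)
Lemma forced_cone r x0 y0 a x y : transitive_orientation r ->
  reversed_edge r x0 y0 -> forced r x0 y0 x y ->
  reversed_edge (reversal r) a x && reversed_edge (reversal r) a y =
  reversed_edge (reversal r) a x0 && reversed_edge (reversal r) a y0.
Proof.
move=> or e0; elim=> [//|{}x {}y _ <-|{}x {}y z xy <- xz yz].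
  by rewrite andbC.
have {}xy := forced_reversed_edge e0 xy.
have push u w : reversed_edge r x w -> u >< w ->
    reversed_edge (reversal r) a x -> reversed_edge (reversal r) a u ->
    reversed_edge (reversal r) a w.
  move=> xw uw ax au.
  have aw : a >=< w.
    rewrite comparable_sym; apply: (no_rainbow (y := x) or).
      by rewrite reversed_edge_sym.
    by rewrite reversed_edge_sym.
  case: (comparable_edge_cases or aw) => // [aw0|awD].
  - by move/negP: uw; case; rewrite -aw0 comparable_sym;
      apply: reversed_edge_comparable au.
  - move/negP: uw; case; rewrite comparable_sym; apply: (no_rainbow or _ au).
    by rewrite reversed_edge_sym.

apply/andP/andP=> -[ax aw]; split=> //.
- by apply: (push z y) => //; rewrite incomparable_sym.
- exact: (push y z).
Qed.

(** * Consequences of proper modules being finite chains *)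

Section ModulesAreChains.
Hypothesis modP : forall A : set P, poset_module A -> A <> [set: P] ->
  finite_set A /\ total_on A (fun x y => x <= y).

Lemma poset_module_incomparable A x y : poset_module A -> A x -> A y ->
  x >< y -> A = [set: P].
Proof.
move=> mA Ax Ay /negP xy; apply: contrapT => /(modP mA)[_ tA].
by case: (tA x y Ax Ay) => [/le_comparable|/ge_comparable].
Qed.

Lemma incomparable_lt u w v : u >< w -> v >=< w -> v < u -> v < w.
Proof.
move=> /negP uw vw vu; case: (comparable_ltgtP vw) => // [wv|E].
- by case: uw; apply/ge_comparable/ltW/(lt_trans wv).
- by case: uw; apply/ge_comparable/ltW; rewrite -E.
Qed.

Lemma incomparable_gt u w v : u >< w -> v >=< w -> u < v -> w < v.
Proof.
move=> /negP uw vw vu; case: (comparable_ltgtP vw) => // [wv|E].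
- by case: uw; apply/le_comparable/ltW/(lt_trans vu).
- by case: uw; apply/le_comparable/ltW; rewrite -E.
Qed.

(* The component of [y] in the incomparability graph of [W] is a poset module,
   although [W] itself need not be one. *)
Lemma graph_module_incomparable W y z : graph_module W -> W y -> W z ->
  y >< z -> W = [set: P].
Proof.
move=> mW Wy Wz yz.
pose K := [set w | clos_refl_trans_n1 P (fun u w => W w /\ u >< w) y w].
have KW w : K w -> W w by elim=> [|u ? []].
have Ky : K y by apply: rtn1_refl.
have Kstep u w : K u -> W w -> u >< w -> K w.
  by move=> Ku Ww uw; apply: rtn1_trans Ku.
suff mK : poset_module K.
  have KT := poset_module_incomparable mK Ky (Kstep _ _ Ky Wz yz) yz.
  by apply/seteqP; split=> // v _; apply: KW; rewrite KT.
move=> v Kv.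
have [inc|cmp] : (forall a, K a -> v >< a) \/ (forall a, K a -> v >=< a).
- have [Wv|/mW[inc|cmp]] := pselect (W v); last 2 first.
  + by left=> a /KW; apply: inc.
  + by right=> a /KW; apply: cmp.
  right=> a Ka; apply: contrapT => /negP va; apply: Kv.
  by apply: Kstep Ka Wv _; rewrite incomparable_sym.
- by constructor 3.
(* Along a step between incomparable elements of [K], [v] stays on the same side: comparable to both
   ends, it would otherwise lie between them and make them comparable. *)
have ltK a : K a -> (v < y -> v < a) /\ (y < v -> a < v).
  move=> Ka; have [] : K a /\ ((v < y -> v < a) /\ (y < v -> a < v)); last by [].
  elim: Ka => [//|u w [Ww uw] _ [Ku [IH1 IH2]]].
  have Kw : K w := Kstep _ _ Ku Ww uw.
  split=> //; split.
    by move=> /IH1; apply: incomparable_lt => //; apply: cmp.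
  by move=> /IH2; apply: incomparable_gt => //; apply: cmp.
case: (comparable_ltgtP (cmp _ Ky)) => [vy|yv|vy].
- by constructor 1=> a /ltK[+ _] => /(_ vy)/ltW.
- by constructor 2=> a /ltK[_ +] => /(_ yv)/ltW.
- by case: Kv; rewrite vy.
Qed.

Lemma forced_spanning r x y z : transitive_orientation r ->
  reversed_edge r x y -> reversed_edge r x z -> y >< z ->
  forall v, exists w, forced r x y v w.
Proof.
move=> or xy xz yz v.
have := graph_module_incomparable (forced_span_module or xy) _ _ yz.
move=> /(_ _ _)/seteqP[]; last by move=> _ /(_ v); apply.
- by exists x; apply/forced_sym/forced_refl.
- by exists x; apply/forced_sym/(forced_step (forced_refl _ _ _)).
Qed.

Definition cherry r x y z :=
  [/\ reversed_edge r x y, reversed_edge r x z & y >< z].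

Lemma cherry_exclusive r x y z x' y' z' : transitive_orientation r ->
  cherry r x y z -> cherry (reversal r) x' y' z' -> False.
Proof.
move=> or [xy xz yz] [xy' xz' yz'].
have or' := transitive_orientation_reversal or.
have spanD := forced_spanning or xy xz yz.
have spanA := forced_spanning or' xy' xz' yz'.
(* As the class spans, [a] is itself an end of one of its edges; transported there, [forced_cone]
   would join [a] to itself. *)
have cone (r1 : rel P) u v a b c : transitive_orientation r1 ->
    reversed_edge r1 u v -> (forall w, exists t, forced r1 u v w t) -> forced r1 u v b c ->
    reversed_edge (reversal r1) a b -> reversed_edge (reversal r1) a c -> False.
  move=> o1 e0 span bc ab ac; have [t at_] := span a.
  have := forced_cone a o1 e0 bc; rewrite ab ac -(forced_cone a o1 e0 at_).
  by rewrite reversed_edge_irr.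
(* Both classes span, so any vertex can serve as their meeting point. The colour of the third side
   [ca] then decides which class receives the forbidden cone. *)
have [c bc] := spanD x; have [a ba] := spanA x.
have Dbc := forced_reversed_edge xy bc.
have Aba := forced_reversed_edge xy' ba.
have ca : c >=< a.
  by apply: (no_rainbow or _ Aba); rewrite reversed_edge_sym.
case: (comparable_edge_cases or ca) => [ca0|caD|caA].
- by apply: (reversed_edge_disjoint or Dbc); rewrite ca0.
- by apply: (cone _ _ _ c x a or' xy' spanA ba) => //; rewrite reversed_edge_sym.
- by apply: (cone _ _ _ a x c or xy spanD bc); rewrite reversed_edge_sym.
Qed.

(** In a chain, the elements strictly below a fixed [x], and those strictly above it, form proper
    modules, hence finite ones. This serves when a disagreement component is all of [P], a case on
    which [modP] is silent. *)
Lemma finite_of_chain : (forall x y, x >=< y) -> finite_set [set: P].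
Proof.
move=> tot.
have [[x _]|noP] := pselect ([set: P] !=set0); last first.
  suff -> : [set: P] = set0 by exact: finite_set0.
  by apply: contrapT => /eqP/set0P.
have proper A : ~ A x -> A <> [set: P] by move=> Ax AT; apply: Ax; rewrite AT.
have [|/=|fd _] := modP (A := [set y | y < x]).
- move=> v /= vx; constructor 2 => a /= ax; apply/ltW/(lt_le_trans ax).
  by case: (comparable_ltgtP (tot v x)) vx.
- by apply: proper; rewrite /= ltxx.
have [|/=|fu _] := modP (A := [set y | x < y]).
- move=> v /= vx; constructor 1 => a /= ax; apply/ltW/(le_lt_trans _ ax).
  by case: (comparable_ltgtP (tot v x)) vx.
- by apply: proper; rewrite /= ltxx.
apply: (@sub_finite_set _ _ ([set y | y < x] `|` [set x] `|` [set y | x < y])).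
  by move=> y _ /=; case: (comparable_ltgtP (tot y x)) => [_|_|->];
    [left; left | right | left; right].
by rewrite !finite_setU; split=> //; split.
Qed.

(** * Disagreement components in the absence of cherries *)

Section NoCherry.
Variable r : rel P.
Hypotheses (or : transitive_orientation r)
  (no_cherry : forall x y z, ~ cherry r x y z).

Definition reversed_component x : set P :=
  [set y | clos_refl_trans_n1 P (reversed_edge r) x y].
Local Notation C := reversed_component.

Lemma reversed_component_refl x : C x x.
Proof. exact: rtn1_refl. Qed.

Lemma reversed_component_sym x y : C x y -> C y x.
Proof.
move=> xy; apply: clos_rt_rtn1; elim: xy => [|u v uv _ IH].
  exact: rt_refl.
by apply: rt_trans IH; apply: rt_step; rewrite reversed_edge_sym.
Qed.

Lemma reversed_component_eq x y : C x y -> C x = C y.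
Proof.
have sub u v : C u v -> C v `<=` C u.
  move=> uv w vw; apply: clos_rt_rtn1; apply: rt_trans; apply: clos_rtn1_rt.
    exact: uv.
  exact: vw.
by move=> xy; apply/seteqP; split; apply: sub => //; apply: reversed_component_sym.
Qed.

(** Induction along a path ending in the edge [uv]: if [xu] is a disagreement edge, incomparable [x]
    and [v] would form a cherry at [u]; if it is an agreement edge, [no_rainbow] applies. *)
Lemma reversed_component_chain x y : C x y -> x >=< y.
Proof.
elim=> [|u v uv _ xu]; first exact: comparablexx.
case: (comparable_edge_cases or xu) => [->|xuD|xuA].
- exact: reversed_edge_comparable uv.
- apply: contrapT => /negP xv; apply: (@no_cherry u x v).
  by split=> //; rewrite reversed_edge_sym.
- rewrite comparable_sym; apply: (no_rainbow or (y := u)).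
    by rewrite reversed_edge_sym.
  by rewrite reversed_edge_sym.
Qed.

(** No disagreement edge leaves the component, so [<] and [r] agree between it and [v]. When
    transitivity of [<] does not carry the comparison across the edge, transitivity of [r] does, and
    the agreement turns it back into [<]. *)
Lemma reversed_edge_uniform x x' v : reversed_edge r x x' ->
  ~ C x v -> (x < v) = (x' < v) /\ (v < x) = (v < x').
Proof.
move=> e Cv; have [ir tr cr] := or.
have nD u w : reversed_edge r u w -> C x u -> C x w.
  by move=> uw xu; apply: rtn1_trans xu.
have kept u : C x u -> (u < v -> r u v) /\ (v < u -> r v u).
  move=> xu; have nuv : ~ reversed_edge r u v by move=> /nD/(_ xu).
  have := cr u v; split=> uv; move: (cr u v); rewrite uv ?orbT /= => /orP[] // ruv;
    by case: nuv; rewrite /reversed_edge uv ruv ?orbT.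
have lt u u' : C x u -> C x u' -> reversed_edge r u u' ->
    (u < v -> u' < v) /\ (v < u -> v < u').
  move=> xu xu' uu'; split=> uv.
  - case/orP: uu' => /andP[uu' ruu']; last exact: lt_trans uv.
    have ru'v := tr _ _ _ ruu' ((kept u xu).1 uv).
    have := cr u' v; rewrite ru'v /=; case/esym/orP=> // vu.
    by have := (kept u' xu').2 vu; rewrite (orientation_asym or ru'v).
  - case/orP: uu' => /andP[uu' ruu']; first exact: lt_trans uu'.
    have ru'v := tr _ _ _ ((kept u xu).2 uv) ruu'.
    have := cr v u'; rewrite ru'v /=; case/esym/orP=> // vu.
    by have := (kept u' xu').1 vu; rewrite (orientation_asym or ru'v).
have Cx := reversed_component_refl x; have Cx' := nD _ _ e Cx.
have e' : reversed_edge r x' x by rewrite reversed_edge_sym.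
have [l1 g1] := lt _ _ Cx Cx' e; have [l2 g2] := lt _ _ Cx' Cx e'.
by split; apply/idP/idP.
Qed.

Lemma reversed_component_uniform x x' v : C x x' -> ~ C x v ->
  (x < v) = (x' < v) /\ (v < x) = (v < x').
Proof.
move=> xx' Cv; elim: xx' => [//|u w uw xu [-> ->]].
by apply: reversed_edge_uniform; rewrite -?(reversed_component_eq xu).
Qed.

Lemma reversed_component_uniform2 x x' y y' : C x x' -> C y y' -> ~ C x y ->
  (x < y) = (x' < y').
Proof.
move=> xx' yy' xy; rewrite (reversed_component_uniform xx' xy).1.
have yx' : ~ C y x'.
  move=> /reversed_component_sym x'y; apply: xy.
  by rewrite (reversed_component_eq xx').
exact: (reversed_component_uniform yy' yx').2.
Qed.

Lemma reversed_component_module x : poset_module (C x).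
Proof.
move=> v Cv.
have unif a : C x a -> (x < v) = (a < v) /\ (v < x) = (v < a).
  by move=> xa; apply: reversed_component_uniform.
have Cne a : C x a -> v != a by move=> xa; apply/eqP => va; apply: Cv; rewrite va.
case: (comparableP v x) => [vx|xv|vx|vx].
- by constructor 1=> a /unif[_ E]; apply: ltW; rewrite -E.
- by constructor 2=> a /unif[E _]; apply: ltW; rewrite -E.
- constructor 3=> a xa; have [E1 E2] := unif _ xa.
  apply/negP=> va; move: E1 E2 (Cne a xa); rewrite (incomparable_ltF vx).
  rewrite incomparable_sym in vx; rewrite (incomparable_ltF vx).
  by case: (comparable_ltgtP va).
- by case: Cv; rewrite vx; apply: reversed_component_refl.
Qed.

Lemma reversed_component_finite x : finite_set (C x).
Proof.
have [CT|/(modP (@reversed_component_module x))[]//] := pselect (C x = [set: P]).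
rewrite CT; apply: finite_of_chain => y z; apply: reversed_component_chain.
by rewrite -(@reversed_component_eq x) CT.
Qed.

(* Each component is a finite chain for both orders; permuting every component
   by its monotone bijection carries [<] to [r]. *)
Lemma no_cherry_embedding :
  exists g : P -> P, injective g /\ forall x y, r (g x) (g y) = (x < y).
Proof.
have [ir tr cr] := or.
pose s x : seq P := finmap.enum_fset (fset_set (C x)).
have sE x y : y \in s x <-> C x y.
  have -> : (y \in s x) = (y \in C x).
    exact: in_fset_set (reversed_component_finite x) y.
  by rewrite in_setE.
(* Sorting requires a relation total on the diagonal too, hence the reflexive closure of [r]. *)
pose re x y := (x == y) || r x y.
pose sP x := sort <=%O (s x); pose sr x := sort re (s x).
have chain x y z : y \in s x -> z \in s x -> y >=< z.
  move=> /sE xy /sE xz; apply: reversed_component_chain.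
  by rewrite -(reversed_component_eq xy).
have sorted_sP x : sorted <=%O (sP x).
  apply: (@sort_sorted_in _ (mem (s x))); last exact/allP.
  by move=> y z /chain/[apply].
have sorted_sr x : sorted re (sr x).
  apply: (@sort_sorted_in _ (mem (s x))); last exact/allP.
  move=> y z /chain/[apply] yz; rewrite /re.
  case: (comparable_ltgtP yz) => //= H; have := cr y z; rewrite H ?orbT //=;
    by case/orP=> ->; rewrite ?orbT.
have re_trans : transitive re.
  move=> y x z; rewrite /re => /predU1P[->//|xy] /predU1P[<-|yz].
    by rewrite xy orbT.
  by rewrite (tr _ _ _ xy yz) orbT.
(* Within its component, [g] sends the element of a given rank for [<=] to the element of the same
   rank for [r]. The index is always in range, so the default [x] is never returned. *)
pose g x := nth x (sr x) (index x (sP x)).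
have s_self x : x \in s x by apply/sE/reversed_component_refl.
have idx x y : C x y -> (index y (sP x) < size (sr x))%N.
  by move=> /sE xy; rewrite size_sort -(size_sort <=%O) index_mem mem_sort.
have g_in x : C x (g x).
  apply/sE; rewrite -(mem_sort re); apply: mem_nth.
  exact/idx/reversed_component_refl.
have mono_in x y : C x y -> x < y -> r (g x) (g y).
  move=> xy ltxy; have sxy : s y = s x by rewrite /s (reversed_component_eq xy).
  have xx := reversed_component_refl x.
  have ltidx : (index x (sP x) < index y (sP x))%N.
    rewrite ltnNge; apply/negP.
    move=> /(sorted_leq_index le_trans (@lexx _ _) (sorted_sP x)).
    have ys : y \in s x by apply/sE.
    by rewrite !mem_sort s_self ys (lt_geF ltxy) => /(_ isT isT).
  have := sorted_ltn_nth re_trans x (sorted_sr x) _ _ (idx _ _ xx) (idx _ _ xy) ltidx.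
  (* Both values are read from the same list, so only the defaults need matching; the equality case
     of [re] is excluded because that list has no duplicates. *)
  rewrite /g /sr /sP sxy (set_nth_default x y) ?idx // => /predU1P[/eqP|//].
  rewrite nth_uniq ?idx ?sort_uniq ?finmap.fset_uniq // => /eqP E.
  by rewrite E ltnn in ltidx.
have mono_out x y : ~ C x y -> (x < y) = (g x < g y) /\ ~ C (g x) (g y).
  move=> xy; split; first exact: (reversed_component_uniform2 (g_in x) (g_in y)).
  rewrite -(reversed_component_eq (g_in x)) => xgy; apply: xy.
  by rewrite (reversed_component_eq xgy); apply/reversed_component_sym.
have mono x y : x < y -> r (g x) (g y).
  have [|xy] := pselect (C x y); first exact: mono_in.
  have [-> gxy] := mono_out _ _ xy => lt; have := cr (g x) (g y).
  (* If [r] pointed the other way, [g x] and [g y] would span a disagreement edge and share a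
     component. *)
  rewrite lt /= => /orP[//|rgyx]; case: gxy.
  apply: rtn1_trans (reversed_component_refl (g x)).
  by rewrite /reversed_edge lt rgyx.
have inc x y : x >< y -> ~~ r (g x) (g y) /\ g x != g y.
  move=> ixy.
  have xy : ~ C x y by move=> /reversed_component_chain; apply/negP.
  have yx : ~ C y x by move=> /reversed_component_sym.
  have [Exy gxy] := mono_out _ _ xy; have [Eyx _] := mono_out _ _ yx.
  split; last by apply/eqP=> E; apply: gxy; rewrite E; apply: reversed_component_refl.
  have := cr (g x) (g y); rewrite -Exy -Eyx incomparable_ltF //.
  by rewrite incomparable_ltF 1?incomparable_sym // => /norP[].
exists g; split=> x y.
- case: (comparableP x y) => // [/mono|/mono|/inc[_ /eqP//]] + E; rewrite E ir //.
- case: (comparableP x y) => [/mono//|/mono gyx|/inc[/negbTE//]|->].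
  + exact: orientation_asym or gyx.
  + exact: ir.
Qed.

End NoCherry.

Lemma orientation_embedding r : transitive_orientation r ->
  exists g : P -> P, injective g /\
    ((forall x y, r (g x) (g y) = (x < y)) \/
     (forall x y, r (g x) (g y) = (y < x))).
Proof.
move=> or; have or' := transitive_orientation_reversal or.
have [no|/existsNP[x /existsNP[y /existsNP[z /contrapT xyz]]]] :=
    pselect (forall x y z, ~ cherry r x y z).
  by have [g [injg gE]] := no_cherry_embedding or no; exists g; split; [|left].
have no' x' y' z' : ~ cherry (reversal r) x' y' z' := cherry_exclusive or xyz.
have [g [injg gE]] := no_cherry_embedding or' no'.
by exists g; split=> //; right=> u v; apply: gE.
Qed.

End ModulesAreChains.

End Reorientation.

(** * Passing between the two graphs, and the equivalence *)

Lemma Comp_lt (d : Order.disp_t) (V : porderType d) (x y : V) :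
  Comp V x y = (x < y) || (y < x).
Proof. by rewrite /Comp /=; case: comparableP. Qed.

Lemma Inc_Comp (d : Order.disp_t) (V : porderType d) (x y : V) :
  Inc V x y = (x != y) && ~~ Comp V x y.
Proof. by rewrite /Inc /Comp /=; case: eqP. Qed.

Lemma Comp_Inc (d : Order.disp_t) (V : porderType d) (x y : V) :
  Comp V x y = (x != y) && ~~ Inc V x y.
Proof. by rewrite /Inc /Comp /= negb_and !negbK; case: eqP. Qed.

Theorem mainTheorem9 (dP dQ : Order.disp_t) (P : porderType dP)
    (Q : porderType dQ)
    (hP : forall A : set P, poset_module A -> A <> [set: P] ->
       finite_set A /\ total_on A (fun x y => x <= y)) :
  [<-> poset_embeds P Q \/ poset_embeds P Q^d;
       graph_embeds (Comp P) (Comp Q);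
       graph_embeds (Inc P) (Inc Q)].
Proof.
tfae.
- move=> [] [f [injf fE]]; exists f; split=> // x y; rewrite !Comp_lt.
  + by rewrite !lt_neqAle !(inj_eq injf) !fE.
  + have fE' u v : (f v <= f u :> Q) = (u <= v) := fE u v.
    by rewrite orbC !lt_neqAle !(inj_eq injf) !fE' [y == x]eq_sym.
- by move=> [f [injf fE]]; exists f; split=> // x y; rewrite !Inc_Comp inj_eq // fE.
- move=> [f [injf fE]].
  (* The map [f] may fail to be monotone: it only makes the pulled-back order another transitive
     orientation of [Comp P]. Precomposing with the self-map [g] of [P] repairs this, up to
     duality. *)
  pose r : rel P := fun x y => f x < f y.
  have or : transitive_orientation r.
    split=> [x|y x z|x y]; rewrite /r; [exact: ltxx|exact: lt_trans|].
    by rewrite -!Comp_lt !Comp_Inc inj_eq // fE.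
  have [g [injg [gE|gE]]] := orientation_embedding hP or; [left|right];
    exists (f \o g); (split; first exact: inj_comp) => x y /=.
  + by rewrite !le_eqVlt (inj_eq injf) (inj_eq injg) -gE.
  + by rewrite leEdual !le_eqVlt eq_sym (inj_eq injf) (inj_eq injg) -gE.
Qed.
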